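(* Let $I\subseteq\{0,\dots,\nu_\varepsilon\}$ be non-empty. The mapping $J\mapsto[v_J]_I$ defines an isomorphism of posets $\mathcal P_I\xrightarrow{\sim}\mathrm{Adm}(\{\mu'\})_I$, where $\mathcal P_I$ is the set of proper subsets of $\overline I$ ordered by inclusion.
   Context: $n\ge2$, $\varepsilon\in\{\pm1\}$, $\underline\varepsilon=(1-\varepsilon)/2$, $\nu_\varepsilon=\lfloor(n-\underline\varepsilon)/2\rfloor$; $\overline r\in\mathbb Z/n\mathbb Z$ is the class of $r\in\mathbb Z$. For non-empty $I\subseteq\{0,\dots,\nu_\varepsilon\}$ put $\overline I=\{\overline r,\overline{-r-\underline\varepsilon}\mid r\in I\}\subseteq\mathbb Z/n\mathbb Z$, and for $i\in\overline I$ put $\ell_i=\min\{1\le\ell\le n\mid i+\ell\in\overline I\}$. Iwahori-Weyl group: $\widetilde W=(\mathbb Z^n\times\mathbb Z)\rtimes\mathfrak S_n$, with elements written $t^xw$ and $w\cdot(x_1,\dots,x_n;m)=(x_{w^{-1}(1)},\dots,x_{w^{-1}(n)};m)$. The affine Weyl group is $W_a=\{t^{(x_1,\dots,x_n;0)}w\mid\sum x_i=0\}$, a Coxeter group with simple reflections $\mathbb S_a=\{s_0,\dots,s_{n-1}\}$ indexed by $\mathbb Z/n\mathbb Z$: $s_j=(j\ j+1)$ for $1\le j\le n-1$ and $s_0=t^{(1,0,\dots,0,-1;0)}(1\ n)$. Put $\tau_0=t^{(1,\dots,1,0;1)}(n\ n-1\ \cdots\ 1)$, $\zeta=t^{(1,\dots,1;1)}$,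 $\Omega=\langle\tau_0,\zeta\rangle\simeq\mathbb Z^2$; then $\widetilde W=W_a\rtimes\Omega$ and $\tau_0s_j\tau_0^{-1}=s_{j-1}$. Length and Bruhat order extend to $\widetilde W$ by $\ell(w\omega)=\ell(w)$, and $w\omega\le w'\omega'$ iff $\omega=\omega'$ and $w\le w'$ ($w,w'\in W_a$, $\omega,\omega'\in\Omega$). $\mathrm{Adm}(\{\mu'\})=\{v\in\widetilde W\mid v\le t^{(1^{j-1},0,1^{n-j};1)}\text{ for some }1\le j\le n\}$. $\mathbb S_a^I=\{s_i\mid i\notin\overline I\}$ and $W_{\mathbb S_a^I}=\langle\mathbb S_a^I\rangle$. $\mathrm{Adm}(\{\mu'\})_I$ is the image of $\mathrm{Adm}(\{\mu'\})$ in $W_{\mathbb S_a^I}\backslash\widetilde W/W_{\mathbb S_a^I}$; $[v]_I$ denotes the double coset of $v$, and $[v]_I\le[v']_I$ iff the minimal length element of $[v]_I$ is $\le$ the minimal length element of $[v']_I$ in the Bruhat order. For $i\in\overline I$ put $w_{B_i}=s_is_{i+1}\cdots s_{i+\ell_i-1}$. For $J\subsetneq\overline I$, pick $i_0\in\overline I\setminus J$ and enumerate $J=\{j_1,\dots,j_k\}$ in the order met when running through $i_0+1,i_0+2,\dots,i_0-1$ in $\mathbb Z/n\mathbb Z$; put $w_J=w_{B_{j_1}}\cdots w_{B_{j_k}}$ (independent of $i_0$) and $v_J=w_J\tau_0$. *)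

(* Defs.v *)
From HB Require Import structures.
From mathcomp Require Import all_boot all_order all_fingroup all_algebra.
From mathcomp Require Import boolp classical_sets functions.
From Stdlib Require Import Relation_Operators.

Set Implicit Arguments.
Unset Strict Implicit.
Unset Printing Implicit Defensive.

Import GRing.Theory.

Local Open Scope classical_set_scope.
Local Open Scope ring_scope.

Definition subgroup_set (G : groupType) (H : set G) : Prop :=
  H 1%g /\ forall x y, H x -> H y -> H (x * y^-1)%g.

Definition generated (G : groupType) (A : set G) : set G :=
  smallest (@subgroup_set G) A.

(* The positions 1, ..., n of the coordinates are represented by their classes in
'Z_n, so that position n is 0 : 'Z_n. All of this is meant for 1 < n, as 'Z_0
and 'Z_1 are convertible to 'Z_2. [IW x m w] is the element t^(x; m) w. *)
Record iwahori_weyl (n : nat) := IW {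
  iw_vec : {ffun 'Z_n -> int};
  iw_mult : int;
  iw_perm : {perm 'Z_n}
}.

Section IwahoriWeylGroup.
Variable n : nat.
Local Notation W := (iwahori_weyl n).

Definition iw_tuple (v : W) := (iw_vec v, iw_mult v, iw_perm v).
Definition iw_of_tuple (p : {ffun 'Z_n -> int} * int * {perm 'Z_n}) : W :=
  IW p.1.1 p.1.2 p.2.

Lemma iw_tupleK : cancel iw_tuple iw_of_tuple.
Proof. by case. Qed.

HB.instance Definition _ := Equality.copy W (can_type iw_tupleK).
HB.instance Definition _ := Choice.copy W (can_type iw_tupleK).

Definition perm_act (w : {perm 'Z_n}) (x : {ffun 'Z_n -> int}) :
    {ffun 'Z_n -> int} :=
  [ffun i => x ((w^-1)%g i)].

Definition iw_one : W := IW 0 0 1%g.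

(* The product s * t of MathComp permutations applies s first, so the composite
   "w after w'" is w' * w. *)
Definition iw_mul (v v' : W) : W :=
  IW (iw_vec v + perm_act (iw_perm v) (iw_vec v'))
     (iw_mult v + iw_mult v')
     (iw_perm v' * iw_perm v)%g.

Definition iw_inv (v : W) : W :=
  IW (- perm_act ((iw_perm v)^-1)%g (iw_vec v)) (- iw_mult v)
     ((iw_perm v)^-1)%g.

Lemma perm_actM w w' x :
  perm_act w (perm_act w' x) = perm_act (w' * w)%g x.
Proof. by apply/ffunP => i; rewrite !ffunE invMg permM. Qed.

Lemma perm_act1 x : perm_act 1%g x = x.
Proof. by apply/ffunP => i; rewrite ffunE invg1 perm1. Qed.

Lemma perm_actD w x y : perm_act w (x + y) = perm_act w x + perm_act w y.
Proof. by apply/ffunP => i; rewrite !ffunE. Qed.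

Lemma perm_actN w x : perm_act w (- x) = - perm_act w x.
Proof. by apply/ffunP => i; rewrite !ffunE. Qed.

Lemma perm_act0 w : perm_act w 0 = 0.
Proof. by apply/ffunP => i; rewrite !ffunE. Qed.

Lemma iw_mulA : associative iw_mul.
Proof.
move=> [x m w] [y p u] [z q t]; rewrite /iw_mul /=.
by rewrite perm_actD perm_actM !addrA mulgA.
Qed.

Lemma iw_mul1 : left_id iw_one iw_mul.
Proof.
by move=> [x m w]; rewrite /iw_mul /= perm_act1 !add0r mulg1.
Qed.

Lemma iw_mulr1 : right_id iw_one iw_mul.
Proof.
by move=> [x m w]; rewrite /iw_mul /= perm_act0 !addr0 mul1g.
Qed.

Lemma iw_mulV : left_inverse iw_one iw_inv iw_mul.
Proof. by move=> [x m w]; rewrite /iw_mul /= !addNr mulgV. Qed.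

Lemma iw_mulrV : right_inverse iw_one iw_inv iw_mul.
Proof.
move=> [x m w]; rewrite /iw_mul /= perm_actN perm_actM mulVg perm_act1.
by rewrite !subrr.
Qed.

HB.instance Definition _ := isGroup.Build W
  iw_mulA iw_mul1 iw_mulr1 iw_mulV iw_mulrV.

Definition affine_weyl : set W :=
  [set v | iw_mult v = 0 /\ \sum_i iw_vec v i = 0].

(* For j = 0 this is t^(1, 0, ..., 0, -1; 0) (1 n), position n being 0; for
   j <> 0 it is the transposition (j j+1). *)
Definition simple_reflection (j : 'Z_n) : W :=
  IW [ffun i => if j == 0 then (i == 1)%:R - (i == 0)%:R else 0] 0
     (tperm j (j + 1)).

(* Its permutation part is i |-> i - 1, the cycle (n n-1 ... 1). *)
Definition tau0 : W :=
  IW [ffun i => if i == 0 then 0 else 1] 1 (perm (@addIr 'Z_n (- 1))).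

Definition zeta : W := IW [ffun=> 1] 1 1%g.

Definition Omega : set W := generated [set tau0; zeta].

Definition word_prod (r : seq 'Z_n) : W :=
  (\big[*%g/1%g]_(j <- r) simple_reflection j)%g.

Definition coxeter_length (w : W) (k : nat) : Prop :=
  (exists2 r, word_prod r = w & size r = k) /\
  (forall r, word_prod r = w -> (k <= size r)%N).

Definition reflection (t : W) : Prop :=
  exists2 w, affine_weyl w & exists j, t = (w * simple_reflection j * w^-1)%g.

Definition bruhat_step (w w' : W) : Prop :=
  (exists2 t, reflection t & w' = (w * t)%g) /\
  (exists k k', [/\ coxeter_length w k, coxeter_length w' k' & (k < k')%N]).

Definition coxeter_bruhat : W -> W -> Prop := clos_refl_trans W bruhat_step.

Definition has_length (v : W) (k : nat) : Prop :=
  exists w om,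
    [/\ affine_weyl w, Omega om, v = (w * om)%g & coxeter_length w k].

Definition bruhat_le (v v' : W) : Prop :=
  exists w w' om,
    [/\ affine_weyl w, affine_weyl w' & Omega om] /\
    [/\ v = (w * om)%g, v' = (w' * om)%g & coxeter_bruhat w w'].

Definition mu'_translation (j : 'Z_n) : W :=
  IW [ffun i => if i == j then 0 else 1] 1 1%g.

Definition Adm : set W := [set v | exists j, bruhat_le v (mu'_translation j)].

(* In use, K is some [Ibar]. *)
Variable K : {set 'Z_n}.

Definition parahoric : set W :=
  generated [set simple_reflection i | i in [set i : 'Z_n | i \notin K]].

Definition double_coset (v : W) : set W :=
  [set u | exists a b, [/\ parahoric a, parahoric b & u = (a * v * b)%g]].

Definition Adm_cosets : set (set W) := double_coset @` Adm.

Definition is_min_length (C : set W) (u : W) : Prop :=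
  C u /\ exists2 k, has_length u k &
    forall v m, C v -> has_length v m -> (k <= m)%N.

Definition double_coset_le (C C' : set W) : Prop :=
  exists u u', [/\ is_min_length C u, is_min_length C' u' & bruhat_le u u'].

(* The least l in {1, ..., n} with i + l in K; it exists if i is in K. *)
Definition gap (i : 'Z_n) : nat :=
  head n [seq l <- iota 1 n | i + l%:R \in K].

Definition wB (i : 'Z_n) : W :=
  (\big[*%g/1%g]_(0 <= k < gap i) simple_reflection (i + k%:R)%R)%g.

(* The product runs through i0 + 1, i0 + 2, ..., i0 - 1; [i0] is in K but not
   in J. *)
Definition wJ (i0 : 'Z_n) (J : {set 'Z_n}) : W :=
  (\big[*%g/1%g]_(1 <= k < n | (i0 + k%:R)%R \in J) wB (i0 + k%:R)%R)%g.

Definition vJ (i0 : 'Z_n) (J : {set 'Z_n}) : W := (wJ i0 J * tau0)%g.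

Definition proper_subsets : set {set 'Z_n} :=
  [set J : {set 'Z_n} | J \proper K].

End IwahoriWeylGroup.

(* The division is exact for eps = 1 and eps = -1. *)
Definition ueps (eps : int) : int := ((1 - eps) %/ 2)%Z.

Definition nu (n : nat) (eps : int) : nat := `|((n%:Z - ueps eps) %/ 2)%Z|%N.

Definition Ibar (n : nat) (eps : int) (I : {set 'I_(nu n eps).+1}) :
    {set 'Z_n} :=
  [set (r%:Z)%:~R | r : 'I_(nu n eps).+1 in I]%SET :|:
  [set (- r%:Z - ueps eps)%:~R | r : 'I_(nu n eps).+1 in I]%SET.

(* Main.v *)
(* The group acts on the integers by the affine permutations: s_j exchanges
   j and j + 1 modulo n, tau_0 is the shift by -1 and zeta is the identity.
   For the Bruhat order everything rests on the exchange condition for this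
   action and on its consequence that the property "some z > j is sent to
   a value <= i" passes from an element to every larger one. When the classes
   of i and j lie in K (that is, Ibar) this property depends only on the double coset. For i
   in K it holds for v_J with respect to (i, i + gap i) exactly when i is in J,
   which gives injectivity and reflection of the order. It also forces every
   word of an element of [v_J] to contain all the letters of v_J, so v_J has
   minimal length, and inclusions between the J become subwords. For
   surjectivity, an admissible element is a subword of s_{c+1}...s_{c+n-1}
   times tau_0; a letter outside K whose predecessor is missing can be absorbed
   on the left, a letter whose successor is missing and outside K on the right
   (as s_d tau_0 = tau_0 s_{d+1}), until a union of blocks remains. *)
Require Import Defs.
From mathcomp Require Import all_boot all_order all_fingroup all_algebra.
From mathcomp Require Import boolp classical_sets functions.
From mathcomp Require Import zify ring.
From Stdlib Require Import Relation_Operators.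

Set Implicit Arguments.
Unset Strict Implicit.
Unset Printing Implicit Defensive.

Import Order.TTheory GRing.Theory Num.Theory.

Local Open Scope ring_scope.

Section AdmissibleSet.
Variable p : nat.
Local Notation n := p.+2.
Local Notation W := (iwahori_weyl n).

(** * Residue classes modulo n and their integer representatives *)

Definition cls (a : int) : 'Z_n := a%:~R.

Lemma clsD a b : cls (a + b) = cls a + cls b.
Proof. exact: intrD. Qed.

Lemma clsB a b : cls (a - b) = cls a - cls b.
Proof. exact: intrB. Qed.

Lemma cls1 : cls 1 = 1. Proof. by []. Qed.

Lemma cls_nat (k : nat) : cls k%:Z = k%:R.
Proof. by []. Qed.

Lemma clsn q : cls (n%:Z * q) = 0.
Proof. by rewrite /cls intrM -pmulrn (pchar_Zp (isT : (1 < n)%N)) mul0r. Qed.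

Lemma cls_eqP a b : reflect (exists q, a = b + n%:Z * q) (cls a == cls b).
Proof.
apply: (iffP eqP) => [e|[q ->]]; last by rewrite clsD clsn addr0.
exists ((a - b) %/ n)%Z.
have : cls (a - b) = 0 by rewrite clsB e subrr.
rewrite {1}(divz_eq (a - b) n) clsD mulrC clsn add0r.
have h0 : 0 <= ((a - b) %% n)%Z by rewrite modz_ge0.
have h1 : ((a - b) %% n)%Z < n%:Z by rewrite ltz_pmod.
case E : ((a - b) %% n)%Z h0 h1 => [k|//] _ hk.
rewrite cls_nat => /(congr1 val); rewrite /= val_Zp_nat // modn_small; last by lia.
by move=> /= k0; rewrite k0 in E; have := divz_eq (a - b) n; rewrite E; lia.
Qed.

(** The representatives run from 1 to n, as the class 0 stands for position n; the wrap is thus from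
    n to 1, where [s_0] and [tau0] carry their translation parts. *)
Definition rep (c : 'Z_n) : int := if c == 0 then n%:Z else (c : nat)%:Z.

Lemma rep0 : rep 0 = n%:Z. Proof. by rewrite /rep eqxx. Qed.

Lemma rep1 : rep 1 = 1. Proof. by rewrite /rep oner_eq0. Qed.

Lemma clsK c : cls (rep c) = c.
Proof.
rewrite /rep; case: eqP => [->|_]; first by rewrite -[n%:Z]mulr1 clsn.
by rewrite cls_nat natr_Zp.
Qed.

Lemma rep_bounds c : 1 <= rep c <= n%:Z.
Proof.
rewrite /rep; case: eqP => [_|/eqP c0]; first by lia.
have : (0 < (c : nat))%N by rewrite lt0n.
by have : (c < n)%N := ltn_ord c; lia.
Qed.

Lemma rep_cls a : 1 <= a <= n%:Z -> rep (cls a) = a.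
Proof.
move=> ha; have := rep_bounds (cls a).
have /cls_eqP[q ->] : cls (rep (cls a)) == cls a by rewrite clsK.
by case: q => [[|q]|q]; nia.
Qed.

Lemma rep_pred c : c != 1 -> rep (c - 1) = rep c - 1.
Proof.
move=> c1; have -> : c - 1 = cls (rep c - 1) by rewrite clsB clsK.
have : rep c != 1 by apply: contra c1 => /eqP e; rewrite -(clsK c) e.
by have := rep_bounds c; move=> ? ?; rewrite rep_cls //; lia.
Qed.

Lemma rep_succ c : c != 0 -> rep (c + 1) = rep c + 1.
Proof.
move=> c0; rewrite -{2}(addrK 1 c) rep_pred ?subrK //.
by rewrite -subr_eq0 addrK.
Qed.

Lemma ord_repr (c c' : 'Z_n) : exists2 k, (k < n)%N & c' = c + k%:R.
Proof.
exists (val (c' - c)); first exact: ltn_ord.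
by rewrite natr_Zp addrC subrK.
Qed.

Lemma addr_nat_inj (c : 'Z_n) (k l : nat) :
  (k < n)%N -> (l < n)%N -> (c + k%:R == c + l%:R) = (k == l).
Proof.
move=> hk hl; apply/eqP/eqP => [/addrI/(congr1 val)|-> //].
by rewrite /= !val_Zp_nat // !modn_small.
Qed.

Lemma addrn (c : 'Z_n) : c + n%:R = c.
Proof. by rewrite pchar_Zp // addr0. Qed.

Lemma Zp_neq1 (c : 'Z_n) : c + 1 != c.
Proof. by rewrite -[X in _ != X]addr0 (inj_eq (addrI c)) oner_eq0. Qed.

(** * The action by affine permutations *)

(** For v = t^(x; m) w, an integer in position c moves to position w(c) and then by n(x_{w(c)} - m).
    Subtracting m makes [zeta] trivial and [tau0] a shift. *)
Definition act (v : W) (a : int) : int :=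
  a + rep (iw_perm v (cls a)) - rep (cls a) +
    n%:Z * (iw_vec v (iw_perm v (cls a)) - iw_mult v).

Lemma cls_act v a : cls (act v a) = iw_perm v (cls a).
Proof. by rewrite /act clsD clsn addr0 clsB clsD !clsK addrAC subrr add0r. Qed.

Lemma actM v v' a : act (v * v')%g a = act v (act v' a).
Proof.
rewrite {2}/act cls_act /act; case: v v' => [x m w] [x' m' w'] /=.
by rewrite !permM !ffunE permK; ring.
Qed.

Lemma act1 a : act 1%g a = a.
Proof. by rewrite /act /= perm1 ffunE; lia. Qed.

Lemma actK v : cancel (act v) (act v^-1%g).
Proof. by move=> a; rewrite -actM mulVg act1. Qed.

Lemma actVK v : cancel (act v^-1%g) (act v).
Proof. by move=> a; rewrite -actM mulgV act1. Qed.

Lemma act_inj v : injective (act v).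
Proof. exact: can_inj (actK v). Qed.

Lemma act_shift v a q : act v (a + n%:Z * q) = act v a + n%:Z * q.
Proof. by rewrite /act clsD clsn addr0; lia. Qed.

(* [zeta] acts trivially, hence the hypothesis on the multipliers. *)
Lemma act_faithful v v' :
  iw_mult v = iw_mult v' -> act v =1 act v' -> v = v'.
Proof.
case: v v' => [x m w] [x' m' w'] /= <- e.
have ew : w = w'.
  apply/permP => c; have := congr1 cls (e (rep c)).
  by rewrite !cls_act !clsK.
rewrite -{w'}ew in e *; congr IW; apply/ffunP => c.
by have := e (rep (w^-1 c)%g); rewrite /act /= clsK permKV => /addrI/mulfI-/(_ isT)/addIr.
Qed.

Lemma act_tau0 a : act (tau0 n) a = a - 1.
Proof.
rewrite /act /= !permE !ffunE.
have [e|ne] := eqVneq (cls a) 1.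
  by rewrite e subrr eqxx rep0 rep1; lia.
by rewrite rep_pred // subr_eq0 (negPf ne); lia.
Qed.

Lemma act_zeta a : act (zeta n) a = a.
Proof. by rewrite /act /= perm1 ffunE; lia. Qed.

Local Notation s := (@simple_reflection n).

Lemma act_s j a : act (s j) a =
  if cls a == j then a + 1 else if cls a == j + 1 then a - 1 else a.
Proof.
rewrite /act /=.
have [->|/eqP nj] := cls a =P j.
  rewrite tpermL; case: eqP => [->|/eqP j0]; rewrite ffunE.
    rewrite add0r eqxx oner_eq0 rep0 rep1 /=; lia.
  by rewrite rep_succ //=; lia.
have [->|/eqP nj1] := cls a =P j + 1.
  rewrite tpermR; case: eqP => [->|/eqP j0]; rewrite ffunE.
    rewrite (add0r (1 : 'Z_n)) eqxx eq_sym oner_eq0 rep0 rep1 /=; lia.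
  by rewrite rep_succ //=; lia.
case: eqP => [j0|_]; rewrite ffunE.
  by move: nj nj1; rewrite j0 (add0r (1 : 'Z_n)) => nj nj1;
  rewrite tpermD ?[_ == cls a]eq_sym // (negPf nj) (negPf nj1) /=; lia.
by rewrite tpermD ?[_ == cls a]eq_sym //=; lia.
Qed.

Lemma s_mulss j : (s j * s j = 1)%g.
Proof.
apply: act_faithful => // a; rewrite actM act1 !act_s.
case: (eqVneq (cls a) j) => [e|ne].
  by rewrite clsD cls1 e (negPf (Zp_neq1 j)) eqxx addrK.
case: (eqVneq (cls a) (j + 1)) => [e|ne1].
  by rewrite clsB cls1 e addrK eqxx subrK.
by rewrite (negPf ne) (negPf ne1).
Qed.

Lemma tau0_s j : (s j * tau0 n = tau0 n * s (j + 1)%R)%g.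
Proof.
apply: act_faithful => [|a]; first by rewrite /= addr0 add0r.
rewrite !actM !act_tau0 !act_s clsB cls1.
have e k : (cls a - 1 == k) = (cls a == k + 1) by rewrite subr_eq.
by rewrite !e; case: (cls a == j + 1); case: (cls a == j + 1 + 1); lia.
Qed.

(** * The degree, and uniqueness of the Omega-component *)

(** The average displacement of the affine permutation over n consecutive integers, hence additive;
    on Omega it is the amount of the translation. *)
Definition wdeg (v : W) : int := \sum_i iw_vec v i - n%:Z * iw_mult v.

Lemma wdegM v v' : wdeg (v * v')%g = wdeg v + wdeg v'.
Proof.
rewrite /wdeg [iw_mult _]/=; under eq_bigr do rewrite !ffunE.
rewrite big_split /= [X in _ + X - _](reindex_inj (@perm_inj _ (iw_perm v))).
under [X in _ + X - _]eq_bigr do rewrite permK.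
by ring.
Qed.

Lemma wdeg1 : wdeg 1%g = 0.
Proof. by rewrite /wdeg /= mulr0 subr0 big1 // => i _; rewrite ffunE. Qed.

Lemma wdegV v : wdeg v^-1%g = - wdeg v.
Proof. by apply/eqP; rewrite -addr_eq0 -wdegM mulVg wdeg1. Qed.

Lemma wdeg_tau0 : wdeg (tau0 n) = - 1.
Proof.
rewrite /wdeg /= (bigD1 0) //= ffunE eqxx add0r.
under eq_bigr => i i0 do rewrite ffunE (negPf i0).
by rewrite sumr_const cardC1 card_ord natz /Zp_trunc /=; lia.
Qed.

Lemma affine_weylE (v : W) : affine_weyl v <-> iw_mult v = 0 /\ wdeg v = 0.
Proof.
split=> -[m0 e]; split=> //.
  by rewrite /wdeg e m0; lia.
by move: e; rewrite /wdeg m0 mulr0 subr0.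
Qed.

Lemma iw_multM (v v' : W) : iw_mult (v * v')%g = iw_mult v + iw_mult v'.
Proof. by []. Qed.

Lemma iw_multV (v : W) : iw_mult v^-1%g = - iw_mult v.
Proof. by []. Qed.

Lemma affine_weylM (v v' : W) :
  affine_weyl v -> affine_weyl v' -> affine_weyl (v * v')%g.
Proof.
move=> /affine_weylE[m e] /affine_weylE[m' e']; apply/affine_weylE.
by rewrite iw_multM wdegM m e m' e' addr0.
Qed.

Lemma affine_weylV (v : W) : affine_weyl v -> affine_weyl v^-1%g.
Proof.
move=> /affine_weylE[m e]; apply/affine_weylE.
by rewrite iw_multV wdegV m e oppr0.
Qed.

Lemma affine_weyl1 : affine_weyl (1%g : W).
Proof. by apply/affine_weylE; rewrite wdeg1. Qed.

Lemma affine_weyl_s j : affine_weyl (s j).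
Proof.
split=> //=; case: (eqVneq j 0) => j0; last by rewrite big1 // => i _; rewrite ffunE.
under eq_bigr do rewrite ffunE.
have sum1 c : \sum_(i : 'Z_n) ((i == c)%:R : int) = 1.
  by rewrite (bigD1 c) //= eqxx big1 ?addr0 // => i /negPf->.
by rewrite big_split /= sumrN !sum1 subrr.
Qed.

Lemma generated_sub (A H : set W) :
  subgroup_set H -> (forall v, A v -> H v) -> forall v, Defs.generated A v -> H v.
Proof. by move=> Hsub AH v; apply; split. Qed.

Lemma generated_incl (A : set W) v : A v -> Defs.generated A v.
Proof. by move=> Av H [_]; apply. Qed.

Lemma generated_subgroup (A : set W) : subgroup_set (Defs.generated A).
Proof.
split=> [H [[]]//|x y Ax Ay H HA].
by have [[_ Hdiv] _] := HA; apply: Hdiv; [apply: Ax|apply: Ay].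
Qed.

Lemma Omega_act (om : W) a : Omega om -> act om a = a + wdeg om.
Proof.
move=> Oom; move: om Oom a; apply: generated_sub => [|om].
  split=> [a|x y hx hy a]; first by rewrite act1 wdeg1 addr0.
  by rewrite actM hx wdegM wdegV; have := hy (act y^-1%g a); rewrite actVK; lia.
case=> -> a; first by rewrite act_tau0 wdeg_tau0.
rewrite act_zeta /wdeg /=; under eq_bigr do rewrite ffunE.
by rewrite sumr_const card_ord natz /Zp_trunc /=; lia.
Qed.

(** The degree and the multiplier vanish on W_a, so both can be read off the product; together they
    determine an element of Omega, which acts by a translation. *)
Lemma Omega_affine_eq (om om' v v' : W) : Omega om -> Omega om' ->
  affine_weyl v -> affine_weyl v' -> (v * om = v' * om')%g -> om = om'.
Proof.
move=> Oom Oom' /affine_weylE[mv dv] /affine_weylE[mv' dv'] e.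
have := congr1 wdeg e; have := congr1 (@iw_mult n) e.
rewrite !iw_multM !wdegM mv dv mv' dv' !add0r => em ed.
by apply: act_faithful => // a; rewrite !Omega_act // ed.
Qed.

Lemma Omega_tau0 : Omega (tau0 n).
Proof. by apply: generated_incl; left. Qed.

(** * Words, reflections and the exchange condition *)

Local Notation word := (@word_prod n).

Lemma word_nil : word [::] = 1%g.
Proof. exact: big_nil. Qed.

Lemma word_cons j r : word (j :: r) = (s j * word r)%g.
Proof. exact: big_cons. Qed.

Lemma word_cat r r' : word (r ++ r') = (word r * word r')%g.
Proof. exact: big_cat. Qed.

Lemma word_rcons r j : word (rcons r j) = (word r * s j)%g.
Proof. by rewrite -cats1 word_cat word_cons word_nil mulg1. Qed.

Lemma affine_weyl_word r : affine_weyl (word r).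
Proof.
elim: r => [|j r ih]; first by rewrite word_nil; exact: affine_weyl1.
by rewrite word_cons; apply: affine_weylM ih; exact: affine_weyl_s.
Qed.

Lemma reflection_s j : reflection (s j).
Proof. by exists 1%g; [exact: affine_weyl1|exists j; rewrite mul1g invg1 mulg1]. Qed.

Lemma reflectionJ (u t : W) :
  affine_weyl u -> reflection t -> reflection (u * t * u^-1)%g.
Proof.
move=> au [w aw [j ->]]; exists (u * w)%g; first exact: affine_weylM.
by exists j; rewrite invgM !mulgA.
Qed.

Lemma reflection_mulg (t : W) : reflection t -> (t * t = 1)%g.
Proof.
move=> [w _ [j ->]].
by rewrite -!mulgA mulKg [X in (w * X)%g]mulgA s_mulss mul1g mulgV.
Qed.

Lemma reflection_affine (t : W) : reflection t -> affine_weyl t.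
Proof.
move=> [w aw [j ->]]; apply: affine_weylM (affine_weylV aw).
by apply: affine_weylM => //; exact: affine_weyl_s.
Qed.

Lemma reflectionK (t : W) : reflection t -> involutive (act t).
Proof. by move=> rt a; rewrite -actM reflection_mulg // act1. Qed.

Lemma act_cls v a b : cls a == cls b -> act v a - a = act v b - b.
Proof. by move=> /cls_eqP[q ->]; rewrite act_shift; lia. Qed.

(** A simple reflection exchanges two classes by opposite displacements and fixes the others;
    conjugation preserves this shape. So one moved point [x] determines [t] everywhere. *)
Lemma reflection_actE (t : W) x z : reflection t -> act t x != x ->
  act t z = if cls z == cls x then z + (act t x - x)
            else if cls z == cls (act t x) then z - (act t x - x) else z.
Proof.
move=> rt tx; case: ifPn => [/(act_cls t) <-|zx]; first by rewrite addrC subrK.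
case: ifPn => [/(act_cls t)|ztx].
  by rewrite reflectionK // => e; rewrite -[LHS](subrK z) e addrC opprB.
move: rt => [w _ [j et]]; move: tx zx ztx; rewrite et !actM.
rewrite -{2 3}(actVK w x) -{1 2 4}(actVK w z).
set b := act _ x; set c := act _ z; rewrite (inj_eq (@act_inj w)) => sb.
rewrite !(cls_act w) !(inj_eq perm_inj) => cb csb; congr act; move: sb csb cb.
rewrite !act_s; case: (eqVneq (cls b) j) => [eb _|_].
  by rewrite clsD eb => /negPf-> /negPf->.
case: (eqVneq (cls b) (j + 1)) => [eb _|_]; last by rewrite eqxx.
by rewrite clsB eb addrK => /negPf-> /negPf->.
Qed.

Lemma reflection_inj (t t' : W) x : reflection t -> reflection t' ->
  act t x != x -> act t' x = act t x -> t = t'.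
Proof.
move=> rt rt' tx e; apply: act_faithful => [|z].
  by have [-> _] := reflection_affine rt; have [-> _] := reflection_affine rt'.
by rewrite (reflection_actE z rt tx) (reflection_actE (x := x) z rt') e.
Qed.

Lemma reflection_descends (t : W) : reflection t -> exists z, act t z < z.
Proof.
move=> rt; have [w _ [j et]] := rt; pose b := act w (rep j).
have tb : act t b != b.
  rewrite et !actM actK (inj_eq (@act_inj _)) act_s clsK eqxx; lia.
case: (ltP (act t b) b) => h; first by exists b.
by exists (act t b); rewrite reflectionK //; lia.
Qed.

(** The letters of [r] act from the last to the first. The pair [act t z < z] starts in this order
    and ends in the opposite one, so some letter reverses it; that letter is the one deleted. *)
Lemma exchange r (t : W) z : reflection t -> act t z < z ->
  act (word r) z < act (word r) (act t z) ->
  exists r', [/\ word r' = (word r * t)%g, subseq r' r & size r = (size r').+1].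
Proof.
move=> rt tz; elim: r => [|j r ih]; first by rewrite word_nil !act1 ltNge ltW.
rewrite word_cons !actM.
have [lt|] := ltP (act (word r) z) (act (word r) (act t z)).
  have [r' [er' sub sz]] := ih lt => _; exists (j :: r').
  by rewrite word_cons er' mulgA /= eqxx sz.
rewrite le_eqVlt (inj_eq (@act_inj _)) [X in X || _]lt_eqF //=.
set y := act (word r) z; set y' := act (word r) _ => y'y hs.
(* A simple reflection moves integers by at most 1, so it can reverse [y' < y] only by exchanging
   two neighbours. *)
have sy : act (s j) y = y' by move: hs; rewrite !act_s; do !case: ifP => _; lia.
have rt' : reflection (word r * t * (word r)^-1)%g.
  by apply: reflectionJ => //; exact: affine_weyl_word.
(* Both reflections send [y] to [y'], which determines them. *)
have sE : s j = (word r * t * (word r)^-1)%g.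
  apply: (reflection_inj (x := y) (reflection_s j) rt'); first by rewrite sy lt_eqF.
  by rewrite !actM actK sy.
exists r; split=> //; last exact: subseq_cons.
have -> : (s j * word r * t = s j * (word r * t * (word r)^-1) * word r)%g.
  by rewrite !mulgA mulgVK.
by rewrite -sE s_mulss mul1g.
Qed.

(** Otherwise exchange would delete a letter from a shortest word of [w] and produce a word of [w']
    shorter than it, although [w'] is longer. Lengths are thereby traded for inequalities between
    integers. *)
Lemma bruhat_stepP (w w' : W) : bruhat_step w w' ->
  exists t, [/\ reflection t, w' = (w * t)%g &
    forall z, act t z < z -> act w (act t z) < act w z].
Proof.
case=> [[t rt ew'] [k [k' [[[r er sr] _] [_ min'] kk']]]].
exists t; split=> // z tz; rewrite lt_neqAle (inj_eq (@act_inj _)) lt_eqF //=.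
rewrite leNgt; apply/negP; rewrite -er => /(exchange rt tz)[r' [er' _ sz]].
have := min' r'; rewrite er' er ew' => /(_ erefl); lia.
Qed.

(** Going down one step reverses some pair z, t z, so exchange applies to the word of the larger
    element and deletes one letter. *)
Lemma bruhat_subword (w w' : W) r' : coxeter_bruhat w w' -> word r' = w' ->
  exists2 r, subseq r r' & word r = w.
Proof.
move=> h; elim: h r' => {w w'} [w w' /bruhat_stepP[t [rt -> up]] r' er'|w r' er'|].
- have [z tz] := reflection_descends rt.
  have [|r [er sub _]] := exchange (r := r') rt tz.
    by rewrite er' !actM reflectionK //; exact: up.
  by exists r; rewrite // er er' -mulgA reflection_mulg // mulg1.
- by exists r'.
move=> w1 w2 w3 _ ih1 _ ih2 r3 /ih2[r2 sub2 /ih1[r1 sub1 e1]].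
by exists r1 => //; exact: subseq_trans sub2.
Qed.

(** * Crossings and cuts *)

(** Positivity of the number of z > j with v(z) <= i, the counting function that describes the
    Bruhat order of affine permutations. *)
Definition crosses (i j : int) (v : W) : Prop :=
  exists2 z : int, j < z & act v z <= i.

Lemma crosses_coxeter_bruhat i j (w w' : W) :
  coxeter_bruhat w w' -> crosses i j w -> crosses i j w'.
Proof.
elim=> {w w'} [w w' /bruhat_stepP[t [rt -> up]] [z jz wz]|//|].
  (* If [act t z] is still beyond [j], it has under [w'] the value that [z] had under [w]. Otherwise
     [t] lowers [z], and going up makes the value at [z] itself smaller. *)
  have [jtz|tzj] := ltP j (act t z); first by exists (act t z); rewrite // actM reflectionK.
  exists z => //; rewrite actM; apply: le_trans wz; apply/ltW/up.
  exact: le_lt_trans tzj jz.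
by move=> w1 w2 w3 _ ih1 _ ih2 /ih1/ih2.
Qed.

Lemma crosses_Omega i j (w om : W) : Omega om ->
  crosses i j (w * om)%g <-> crosses i (j + wdeg om) w.
Proof.
move=> Oom; split=> -[z jz wz].
  by exists (z + wdeg om); [lia|move: wz; rewrite actM (Omega_act _ Oom)].
exists (z - wdeg om); first by lia.
by rewrite actM (Omega_act _ Oom) subrK.
Qed.

Lemma crosses_bruhat_le i j (v v' : W) :
  bruhat_le v v' -> crosses i j v -> crosses i j v'.
Proof.
move=> [w [w' [om [[_ _ Oom] [-> -> ww']]]]].
by rewrite !crosses_Omega //; exact: crosses_coxeter_bruhat.
Qed.

Definition preserves_cut (i : int) (v : W) : Prop :=
  forall z, (act v z <= i) = (z <= i).

Lemma preserves_cut_subgroup i : subgroup_set (preserves_cut i).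
Proof.
split=> [z|x y hx hy z]; first by rewrite act1.
by rewrite actM hx -(hy (act y^-1%g z)) actVK.
Qed.

Lemma preserves_cutV i v : preserves_cut i v -> preserves_cut i v^-1%g.
Proof. by move=> hv z; rewrite -hv actVK. Qed.

(** The only simple reflection that exchanges integers across the cut between i and i + 1 is the one
    indexed by the class of i. *)
Lemma preserves_cut_s i j : cls i != j -> preserves_cut i (s j).
Proof.
move=> ij z; rewrite act_s; case: eqP => [zj|_].
  have : z != i by apply: contraNneq ij => <-; rewrite zj.
  lia.
case: eqP => // zj; have : z != i + 1.
  by apply: contraNneq ij => e; move: zj; rewrite e clsD cls1 => /addIr->.
lia.
Qed.

Lemma preserves_cut_word i r : cls i \notin r -> preserves_cut i (word r).
Proof.
elim: r => [|j r ih]; first by rewrite word_nil => _ z; rewrite act1.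
rewrite inE negb_or => /andP[ij /ih hr] z.
by rewrite word_cons actM preserves_cut_s.
Qed.

(** * Words of consecutive letters and words with distinct letters *)

Definition arc (c : 'Z_n) (l : nat) : seq 'Z_n := [seq c + k%:R | k <- iota 0 l].

Lemma arcD c l m : arc c (l + m) = arc c l ++ arc (c + l%:R) m.
Proof.
rewrite /arc iotaD map_cat add0n -[X in iota X m]addn0 iotaDl -map_comp.
by congr (_ ++ _); apply: eq_map => k /=; rewrite natrD addrA.
Qed.

Lemma arcS c l : arc c l.+1 = c :: arc (c + 1) l.
Proof. by rewrite -[l.+1]add1n arcD /= addr0. Qed.

Lemma arcSr c l : arc c l.+1 = rcons (arc c l) (c + l%:R).
Proof. by rewrite -[l.+1]addn1 arcD -cats1 /arc /= addr0. Qed.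

Lemma arcP c l d : reflect (exists2 k, (k < l)%N & d = c + k%:R) (d \in arc c l).
Proof.
by apply: (iffP mapP) => -[k hk ->]; exists k; rewrite ?mem_iota // in hk *.
Qed.

Lemma arc_uniq c l : (l <= n)%N -> uniq (arc c l).
Proof.
move=> ln; rewrite map_inj_in_uniq ?iota_uniq // => k k'.
rewrite !mem_iota !add0n /= => hk hk' /eqP.
by rewrite addr_nat_inj ?(leq_trans _ ln) // => /eqP.
Qed.

Lemma mem_arc_full c d : d \in arc c n.
Proof. by apply/arcP; have [k ? ?] := ord_repr c d; exists k. Qed.

Lemma act_arc i l : act (word (arc (cls i) l)) (i + l%:Z) = i.
Proof.
elim: l => [|l ih]; first by rewrite word_nil act1 addr0.
rewrite arcSr word_rcons actM act_s.
have -> : cls (i + l.+1%:Z) = cls i + l%:R + 1.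
  by rewrite clsD cls_nat mulrSr addrA.
rewrite (negPf (Zp_neq1 _)) eqxx -[RHS]ih; congr act; lia.
Qed.

(** The arc carries i + l down to i. The right factor preserves the cut after i + l - 1 and the left
    one the cut after i, so neither undoes the crossing. *)
Lemma crosses_arc i l r1 r2 : (0 < l)%N -> cls i \notin r1 ->
  cls i + l.-1%:R \notin r2 ->
  crosses i (i + l.-1%:Z) (word (r1 ++ arc (cls i) l ++ r2)).
Proof.
move=> l0 ir1 ir2; exists (act (word r2)^-1%g (i + l%:Z)).
  rewrite ltNge preserves_cutV; first by lia.
  by apply: preserves_cut_word; rewrite clsD cls_nat.
rewrite !word_cat !actM actVK act_arc.
by rewrite preserves_cut_word.
Qed.

(** A word without the letter h preserves the cut after h, which lies between the source beyond j
    and the target at most i. *)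
Lemma crosses_letters i j r h :
  crosses i j (word r) -> i <= h <= j -> cls h \in r.
Proof.
move=> [z jz rz] hh; apply/negPn/negP => /preserves_cut_word/(_ z); lia.
Qed.

(** Hence words with distinct letters are reduced. A letter occurring once is an arc of length 1, so
    it produces a crossing which every other word of the same element has to realise. *)
Lemma uniq_word_letters r r' : uniq r -> word r' = word r -> {subset r <= r'}.
Proof.
move=> ur er d /path.splitPr dr; case: dr ur er => r1 r2.
rewrite cat_uniq /= negb_or => /and3P[_ /andP[dr1 _] /andP[dr2 _]] er.
have := @crosses_arc (rep d) 1 r1 r2; rewrite /arc /= clsK addr0 -er => h.
by rewrite -(clsK d); apply: (crosses_letters (h isT dr1 dr2)); lia.
Qed.

Lemma coxeter_length_uniq r : uniq r -> coxeter_length (word r) (size r).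
Proof.
move=> ur; split; first by exists r.
by move=> r' /(uniq_word_letters ur); apply: uniq_leq_size.
Qed.

Lemma bruhat_step_uniq r1 r2 d : uniq (r1 ++ d :: r2) ->
  bruhat_step (word (r1 ++ r2)) (word (r1 ++ d :: r2)).
Proof.
move=> u; have u' : uniq (r1 ++ r2).
  by apply: subseq_uniq u; apply: cat_subseq => //; exact: subseq_cons.
split; last first.
  exists (size (r1 ++ r2)), (size (r1 ++ d :: r2)); split.
  - exact: coxeter_length_uniq.
  - exact: coxeter_length_uniq.
  by rewrite !size_cat /= addnS.
exists ((word r2)^-1 * s d * word r2)%g.
  rewrite -{2}(invgK (word r2)); apply: reflectionJ; last exact: reflection_s.
  exact/affine_weylV/affine_weyl_word.
by rewrite !word_cat word_cons !mulgA mulgK.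
Qed.

Lemma subseq_bruhat r1 r2 : uniq r2 -> subseq r1 r2 ->
  coxeter_bruhat (word r1) (word r2).
Proof.
(* The Bruhat order is not stable under left multiplication, so letters common to both words are
   collected in a prefix [r0]. *)
suff prefixed r0 : uniq (r0 ++ r2) -> subseq r1 r2 ->
    coxeter_bruhat (word (r0 ++ r1)) (word (r0 ++ r2)) by exact: (prefixed [::]).
elim: r2 r0 r1 => [|d r2 ih] r0 r1 u.
  by rewrite subseq0 => /eqP->; apply: rt_refl.
have step : coxeter_bruhat (word (r0 ++ r2)) (word (r0 ++ d :: r2)).
  by apply: rt_step; exact: bruhat_step_uniq.
have u' : uniq (r0 ++ r2).
  by apply: subseq_uniq u; apply: cat_subseq => //; exact: subseq_cons.
have skip r : subseq r r2 -> coxeter_bruhat (word (r0 ++ r)) (word (r0 ++ d :: r2)).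
  by move=> sub; apply: rt_trans step; apply: ih.
case: r1 => [|d' r1] /=; first by move=> _; apply: skip; exact: sub0seq.
case: eqP => [->|_]; last exact: skip.
by rewrite -!cat_rcons; apply: ih; rewrite cat_rcons.
Qed.

(** * The admissible set in terms of subwords *)

(** As m < n, the classes c, ..., c + m are distinct and the word acts as a cycle on them: the last
    is carried to the front and the others move up by 1. *)
Lemma act_arcE c m k z : (m < n)%N -> (k < n)%N -> cls z = c + k%:R ->
  act (word (arc c m)) z =
    if k == m then z - m%:Z else if (k < m)%N then z + 1 else z.
Proof.
elim: m k z => [|m ih] k z hm hk hz.
  by rewrite word_nil act1 ltn0; case: eqP => _; lia.
rewrite arcSr word_rcons actM act_s hz addr_nat_inj //; last by lia.
have mn : (m < n)%N := ltnW hm.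
case: (eqVneq k m) => [e|km].
  have hz1 : cls (z + 1) = c + m.+1%:R by rewrite clsD hz e cls1 -addrA -mulrSr.
  by rewrite (ih _ _ mn hm hz1) e gtn_eqF // ltn_eqF // ltnSn ltnNge leqnSn.
rewrite -addrA -mulrSr addr_nat_inj //; case: (eqVneq k m.+1) => [e|km1].
  have hz1 : cls (z - 1) = c + m%:R by rewrite clsB hz e cls1 mulrSr addrA addrK.
  by rewrite (ih _ _ mn mn hz1) eqxx; lia.
by rewrite (ih _ _ mn hk hz) (negPf km) [in RHS]ltnS [in RHS]leq_eqVlt (negPf km).
Qed.

(** The shift by -1 followed by the arc of n - 1 letters restores every class except that of j,
    which is lowered by 1 + (n - 1) = n, as by the translation. *)
Lemma mu'_word j : mu'_translation j = (word (arc j p.+1) * tau0 n)%g.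
Proof.
apply: act_faithful => [|a].
  by rewrite iw_multM; have [-> _] := affine_weyl_word (arc j p.+1).
have [k hk e] := ord_repr j (cls (a - 1)).
rewrite actM act_tau0 (act_arcE _ hk e) //.
have -> : act (mu'_translation j) a = if cls a == j then a - n%:Z else a.
  by rewrite /act /= perm1 ffunE; case: ifP => _; lia.
have -> : cls a = j + k.+1%:R by rewrite mulrSr addrA -e clsB cls1 subrK.
case: (eqVneq k p.+1) => [->|kp]; first by rewrite addrn eqxx; lia.
have -> : (j + k.+1%:R == j) = false.
  by rewrite -{2}[j]addr0 -[0]/(0%:R) addr_nat_inj //; lia.
have kp' : (k < p.+1)%N by lia.
by rewrite kp' subrK.
Qed.

Lemma AdmE v : Adm v <->
  exists j r, subseq r (arc j p.+1) /\ v = (word r * tau0 n)%g.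
Proof.
split=> [[j [w [w' [om [[aw aw' Oom] [-> emu le]]]]]]|[j [r [sub ->]]]].
  rewrite mu'_word in emu.
  have eom := Omega_affine_eq Omega_tau0 Oom (affine_weyl_word _) aw' emu.
  have [r sub er] := bruhat_subword le (mulIg (tau0 n) _ _ (etrans emu (congr1 (fun x => w' * x)%g (esym eom)))).
  by exists j, r; rewrite er eom.
exists j, (word r), (word (arc j p.+1)), (tau0 n); split.
  by split; [exact: affine_weyl_word|exact: affine_weyl_word|exact: Omega_tau0].
by rewrite mu'_word; split=> //; apply: subseq_bruhat => //; exact: arc_uniq.
Qed.

(** * Words of sets of letters in cyclic order *)

Definition cword (c : 'Z_n) (D : {set 'Z_n}) : seq 'Z_n :=
  [seq d <- arc c n | d \in D].

Lemma cword_uniq c D : uniq (cword c D).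
Proof. by rewrite filter_uniq // arc_uniq. Qed.

Lemma mem_cword c D d : (d \in cword c D) = (d \in D).
Proof. by rewrite mem_filter mem_arc_full andbT. Qed.

Lemma s_comm a b : b != a + 1 -> a != b + 1 -> (s a * s b = s b * s a)%g.
Proof.
have [-> //|ab] := eqVneq a b; move=> ba1 ab1.
have [nab nba1] : b + 1 != a + 1 /\ a - 1 != b.
  by rewrite (inj_eq (addIr 1)) eq_sym ab subr_eq.
have [nba nab1] : a + 1 != b + 1 /\ b - 1 != a.
  by rewrite eq_sym nab subr_eq.
apply: act_faithful => // z; rewrite !actM !act_s.
case: (eqVneq (cls z) a) => [e|ea].
  rewrite e (negPf ab) (negPf ab1) e eqxx clsD e cls1.
  by rewrite (eq_sym _ b) (negPf ba1) (negPf nba).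
case: (eqVneq (cls z) (a + 1)) => [e|ea1].
  rewrite e (eq_sym _ b) (negPf ba1) (negPf nba) e (negPf (Zp_neq1 a)) eqxx.
  by rewrite clsB e cls1 addrK (negPf ab) (negPf ab1).
case: (eqVneq (cls z) b) => [e|eb].
  by rewrite clsD e cls1 (negPf nab) eq_sym (negPf ab1).
case: (eqVneq (cls z) (b + 1)) => [e|eb1].
  by rewrite clsB e cls1 addrK (negPf ba1) eq_sym (negPf ab).
by rewrite (negPf ea) (negPf ea1).
Qed.

Lemma word_comm r r' :
  (forall a b, a \in r -> b \in r' -> b != a + 1 /\ a != b + 1) ->
  (word r * word r' = word r' * word r)%g.
Proof.
elim: r => [|a r ih] h; first by rewrite word_nil mul1g mulg1.
rewrite word_cons -mulgA ih => [|x b xr]; last by apply: h; rewrite inE xr orbT.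
rewrite !mulgA; congr (_ * _)%g.
elim: r' h {ih} => [|b r' ih] h; first by rewrite word_nil mul1g mulg1.
have [ba ab] := h a b (mem_head _ _) (mem_head _ _).
rewrite word_cons mulgA s_comm // -mulgA ih ?mulgA // => x y xr yr.
by apply: h; rewrite // inE yr orbT.
Qed.

(* The two arcs between c and c' avoid c and c', so that their letters in D
   commute. *)
Lemma word_cword c c' (D : {set 'Z_n}) : c \notin D -> c' \notin D ->
  word (cword c D) = word (cword c' D).
Proof.
have [m mn ->] := ord_repr c c' => cD c'D.
have e : arc c n = arc c m ++ arc (c + m%:R) (n - m) by rewrite -arcD subnKC // ltnW.
have e' : arc (c + m%:R) n = arc (c + m%:R) (n - m) ++ arc c m.
  by rewrite -[X in arc _ X = _](subnK (ltnW mn)) arcD -addrA -natrD subnKC ?addrn // ltnW.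
rewrite /cword e e' !filter_cat !word_cat; apply: word_comm => a b.
rewrite !mem_filter => /andP[aD /arcP[k km ak]] /andP[bD /arcP[l lm bl]].
have k0 : k != 0%N by apply: contraNneq cD => k0; rewrite k0 addr0 in ak; rewrite -ak.
have l0 : l != 0%N by apply: contraNneq c'D => l0; rewrite l0 addr0 in bl; rewrite -bl.
rewrite ak bl -!addrA -!mulrSr -!natrD.
split; first by rewrite addr_nat_inj; lia.
have [->|ne] := eqVneq (m + l.+1)%N n; last by rewrite addr_nat_inj; lia.
by rewrite addrn -{2}[c]addr0 -[0]/(0%:R) addr_nat_inj; lia.
Qed.

(** Choosing the base point just before [d] brings [d] to the left end; in [cword_succ], the base
    point just after [d] brings it to the right end, next to [tau0]. *)
Lemma cword_pred d (D : {set 'Z_n}) : d \in D -> d - 1 \notin D ->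
  cword (d - 1) D = d :: cword (d - 1) (D :\ d).
Proof.
move=> dD d1D; rewrite /cword !arcS subrK /= !inE dD (negPf d1D) eqxx andbF.
congr cons; apply/eq_in_filter => x xa; rewrite !inE; case: eqP => // e.
by have := arc_uniq (d - 1) (leqnn n); rewrite !arcS subrK /= -[X in X \notin arc (d + 1) p]e xa /= andbF.
Qed.

Lemma cword_succ d (D : {set 'Z_n}) : d \in D -> d + 1 \notin D ->
  cword (d + 1) D = rcons (cword (d + 1) (D :\ d)) d.
Proof.
move=> dD d1D.
have e : arc (d + 1) n = rcons (arc (d + 1) p.+1) d.
  by rewrite arcSr -addrA nat1r addrn.
rewrite /cword e !filter_rcons dD setD11.
congr rcons; apply/eq_in_filter => x xa; rewrite !inE; case: eqP => // ex.
by have := arc_uniq (d + 1) (leqnn n); rewrite e rcons_uniq -[X in X \notin _]ex xa.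
Qed.

(** * The parahoric subgroup and its double cosets *)

Variable K : {set 'Z_n}.
Local Notation dcoset := (double_coset K).
Local Notation parahoric := (parahoric K).
Local Notation gap := (gap K).

Lemma parahoric_s j : j \notin K -> parahoric (s j).
Proof. by move=> jK; apply: generated_incl; exists j => //=; rewrite inE. Qed.

Lemma parahoric_subgroup : subgroup_set parahoric.
Proof. exact: generated_subgroup. Qed.

Lemma parahoric1 : parahoric 1%g. Proof. exact: parahoric_subgroup.1. Qed.

Lemma parahoricV a : parahoric a -> parahoric a^-1%g.
Proof.
by move=> pa; rewrite -[(a^-1)%g]mul1g; apply: parahoric_subgroup.2 parahoric1 pa.
Qed.

Lemma parahoricM a b : parahoric a -> parahoric b -> parahoric (a * b)%g.
Proof.
by move=> pa /parahoricV pb; rewrite -[b]invgK; exact: parahoric_subgroup.2.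
Qed.

Lemma parahoric_affine a : parahoric a -> affine_weyl a.
Proof.
apply: generated_sub => [|_ [j _ <-]]; last exact: affine_weyl_s.
split=> [|x y ax ay]; first exact: affine_weyl1.
exact/affine_weylM/affine_weylV.
Qed.

Lemma parahoric_preserves_cut a i :
  cls i \in K -> parahoric a -> preserves_cut i a.
Proof.
move=> iK; move: a; apply: generated_sub => [|_ [j /= jK <-]].
  exact: preserves_cut_subgroup.
by apply: preserves_cut_s; apply: contraTneq iK => ->; move: jK; rewrite ?inE.
Qed.

Lemma dcoset_refl v : dcoset v v.
Proof. by exists 1%g, 1%g; rewrite mul1g mulg1; split=> //; exact: parahoric1. Qed.

Lemma dcoset_sub a b v : parahoric a -> parahoric b ->
  (dcoset (a * v * b)%g `<=` dcoset v)%classic.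
Proof.
move=> pa pb _ [a' [b' [pa' pb' ->]]]; exists (a' * a)%g, (b * b')%g.
by rewrite !mulgA; split=> //; exact: parahoricM.
Qed.

Lemma dcoset_mul a b v : parahoric a -> parahoric b ->
  dcoset (a * v * b)%g = dcoset v.
Proof.
move=> pa pb; apply/seteqP; split; first exact: dcoset_sub.
have {1}-> : v = (a^-1 * (a * v * b) * b^-1)%g by rewrite !mulgA mulVg mul1g mulgK.
by apply: dcoset_sub; exact: parahoricV.
Qed.

(** The right factor preserves the cut after j, beyond which the source lies, and the left factor
    the cut after i, before which the target lies. *)
Lemma crosses_dcoset i j u v : cls i \in K -> cls j \in K -> dcoset v u ->
  crosses i j v -> crosses i j u.
Proof.
move=> iK jK [a [b [pa pb ->]]] [z jz vz]; exists (act b^-1%g z).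
  by rewrite ltNge (parahoric_preserves_cut jK (parahoricV pb)) -ltNge.
by rewrite !actM actVK (parahoric_preserves_cut iK pa).
Qed.

(** * Reduction to unions of blocks *)

(** For non-empty [K] these are the unions of runs i, ..., i + gap i - 1 with i in [K], so that
    [D :&: K] determines [D]. *)
Definition blocky (D : {set 'Z_n}) : Prop :=
  forall d, d \notin K -> (d \in D) = (d - 1 \in D).

Local Notation vD c D := (word (cword c D) * tau0 n)%g.

(** Induction on the number of letters: where [D] fails to be blocky, one letter is absorbed, after
    moving the base point next to it. *)
Lemma dcoset_vD_blocky c (D : {set 'Z_n}) : c \notin D ->
  exists D' : {set 'Z_n}, [/\ c \notin D', blocky D' & dcoset (vD c D) = dcoset (vD c D')].
Proof.
have [m] := ubnP #|D|; elim: m D => // m ih D /ltnSE leD cD.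
have reduce d : d \in D ->
    dcoset (vD c D) = dcoset (vD c (D :\ d)) ->
    exists D' : {set 'Z_n}, [/\ c \notin D', blocky D' & dcoset (vD c D) = dcoset (vD c D')].
  move=> dD e; have [||D' [cD' bD' e']] := ih (D :\ d).
  - by move: leD; rewrite (cardsD1 d) dD.
  - by rewrite !inE (negPf cD) andbF.
  by exists D'; rewrite e e'.
have cDd d : c \notin D :\ d by rewrite !inE (negPf cD) andbF.
have [[d [dK dD d1D]]|nleft] := pselect (exists d, [/\ d \notin K, d \in D & d - 1 \notin D]).
  apply: (reduce d) => //; have d1Dd : d - 1 \notin D :\ d by rewrite !inE (negPf d1D) andbF.
  rewrite (word_cword cD d1D) (word_cword (cDd d) d1Dd) cword_pred //.
  rewrite word_cons -[X in dcoset X]mulg1 -mulgA -mulgA [X in (s d * X)%g]mulgA.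
  by rewrite mulgA dcoset_mul //; [exact: parahoric_s|exact: parahoric1].
(* The letter removed is [d - 1], which may lie in [K]: beyond [tau0] it turns into [s_d], and [d]
   is outside [K]. *)
have [[d [dK dD d1D]]|nright] := pselect (exists d, [/\ d \notin K, d \notin D & d - 1 \in D]).
  apply: (reduce (d - 1)) => //; have dDd : d \notin D :\ (d - 1) by rewrite !inE (negPf dD) andbF.
  rewrite (word_cword cD dD) (word_cword (cDd _) dDd) -{1}[d](subrK 1) cword_succ ?subrK //.
  rewrite word_rcons -mulgA tau0_s subrK mulgA.
  by rewrite -[X in dcoset (X * s d)%g]mul1g (dcoset_mul _ parahoric1 (parahoric_s dK)).
exists D; split=> // d dK; apply/idP/idP => h; apply: contrapT => /negP h'.
  by apply: nleft; exists d.
by apply: nright; exists d.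
Qed.

(** * Gaps, blocks and the word of w_J *)

Lemma head_filter_iota (P : pred nat) x m l : has P (iota m l) ->
  let h := head x [seq k <- iota m l | P k] in
  [/\ P h, (m <= h < m + l)%N & forall k, (m <= k < h)%N -> ~~ P k].
Proof.
elim: l m => [//|l ih] m /=; case: ifP => [Pm _ /=|Pm /= /ih[Ph hh hmin]].
  by split=> //; [lia|move=> k; lia].
split=> //; first by lia.
move=> k hk; have [->|km] := eqVneq k m; first by rewrite Pm.
by apply: hmin; lia.
Qed.

Lemma gapP i : i \in K ->
  [/\ i + (gap i)%:R \in K, (0 < gap i <= n)%N &
      forall k, (0 < k < gap i)%N -> i + k%:R \notin K].
Proof.
move=> iK; have [|h1 h2 h3] := @head_filter_iota (fun l => i + l%:R \in K) n 1 n.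
  (* Going once round the circle returns to [i], so the search always succeeds and the default of
     [head] is never reached. *)
  by apply/hasP; exists n; rewrite ?mem_iota ?addrn //; lia.
by split=> //; rewrite /gap /Defs.gap; lia.
Qed.

Lemma gap_le i l : i \in K -> i + l%:R \in K -> (0 < l)%N -> (gap i <= l)%N.
Proof.
move=> iK ilK l0; rewrite leqNgt; apply/negP => lg.
by have [_ _ /(_ l)] := gapP iK; rewrite ilK l0 lg => /(_ isT).
Qed.

Lemma blocky_gap (D : {set 'Z_n}) i l : blocky D -> i \in K -> (l < gap i)%N ->
  (i + l%:R \in D) = (i \in D).
Proof.
move=> bD iK; elim: l => [|l ih] hl; first by rewrite addr0.
have [_ _ inner] := gapP iK.
rewrite -ih 1?ltnW // bD; last by apply: inner; rewrite hl.
by rewrite mulrSr addrA addrK.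
Qed.

Lemma wB_word i : wB K i = word (arc i (gap i)).
Proof. by rewrite /wB /word_prod big_map /index_iota subn0. Qed.

(** Cut off one gap at a time: only its first letter is in [K], and a blocky [D] contains the whole
    run or misses it. *)
Lemma prod_wB (D : {set 'Z_n}) i m : blocky D -> i \in K -> i + m%:R \in K ->
  (\prod_(d <- arc i m | d \in D :&: K) wB K d)%g = word [seq d <- arc i m | d \in D].
Proof.
move=> bD; have [b] := ubnP m; elim: b m i => // b ih m i /ltnSE mb iK mK.
have [->|m0] := posnP m; first by rewrite big_nil word_nil.
have gm := gap_le iK mK m0; have [gK /andP[g0 _] inner] := gapP iK.
rewrite -(subnKC gm) arcD big_cat filter_cat word_cat /=.
rewrite (ih (m - gap i)%N) //; [|lia|by rewrite -addrA -natrD subnKC].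
congr (_ * _)%g; rewrite -{1}(prednK g0) arcS big_cons big1_seq => [|d]; last first.
  move=> /andP[+ /arcP[k hk ed]]; rewrite inE ed -addrA nat1r => /andP[_].
  by rewrite (negPf (inner k.+1 _)) //=; lia.
rewrite inE iK andbT mulg1 wB_word.
rewrite (@eq_in_filter _ _ (fun=> i \in D)) => [|d /arcP[l hl ->]]; last exact: blocky_gap.
by case: ifP => _; rewrite ?filter_predT // filter_pred0 word_nil.
Qed.

Lemma wJ_word i0 (D : {set 'Z_n}) : blocky D -> i0 \in K -> i0 \notin D ->
  wJ K i0 (D :&: K) = word (cword i0 D).
Proof.
move=> bD i0K i0D; rewrite /cword -prod_wB ?addrn //.
(* [wJ] starts at i0 + 1 and the arc at i0; the extra factor is absent because [i0] is not in
   [D]. *)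
by rewrite /arc big_map big_cons addr0 inE (negPf i0D).
Qed.

(** On subsets of [K], the inverse of intersecting a blocky set with [K]. *)
Definition blocks (J : {set 'Z_n}) : {set 'Z_n} :=
  [set d | [exists i in J, d \in arc i (gap i)]].

Lemma blocksP (J : {set 'Z_n}) d :
  reflect (exists i l, [/\ i \in J, (l < gap i)%N & d = i + l%:R]) (d \in blocks J).
Proof.
rewrite inE; apply: (iffP existsP) => [[i /andP[iJ /arcP[l hl ->]]]|[i [l [iJ hl ->]]]].
  by exists i, l.
by exists i; rewrite iJ; apply/arcP; exists l.
Qed.

Lemma blocks_blocky (J : {set 'Z_n}) : J \subset K -> blocky (blocks J).
Proof.
move=> /fintype.subsetP JK d dK; apply/blocksP/blocksP => -[i [l [iJ hl e]]].
  case: l => [|l] in hl e; first by case/negP: dK; rewrite e addr0 JK.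
  by exists i, l; rewrite e mulrSr addrA addrK ltnW.
exists i, l.+1; have ed : d = i + l.+1%:R by rewrite mulrSr addrA -e subrK.
split=> //; rewrite ltn_neqAle hl andbT; apply: contraNneq dK => el.
by rewrite ed el; have [] := gapP (JK _ iJ).
Qed.

Lemma blocksI (J : {set 'Z_n}) : J \subset K -> blocks J :&: K = J.
Proof.
move=> /fintype.subsetP JK; apply/setP => d; rewrite inE; apply/andP/idP.
  move=> [/blocksP[i [l [iJ hl ->]]] dK].
  have [_ _ inner] := gapP (JK _ iJ).
  case: l => [|l] in hl dK *; first by rewrite addr0.
  by have := inner l.+1; rewrite dK hl => /(_ isT).
move=> dJ; split; last exact: JK.
apply/blocksP; exists d, 0%N; rewrite addr0.
by have [_ /andP[-> _] _] := gapP (JK _ dJ).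
Qed.

Lemma blocksS (J J' : {set 'Z_n}) : J \subset J' -> blocks J \subset blocks J'.
Proof.
move=> /fintype.subsetP JJ'; apply/fintype.subsetP => d /blocksP[i [l [iJ hl ->]]].
by apply/blocksP; exists i, l; rewrite JJ'.
Qed.

Lemma vJ_word i0 (J : {set 'Z_n}) : J \subset K -> i0 \in K -> i0 \notin J ->
  i0 \notin blocks J /\ vJ K i0 J = vD i0 (blocks J).
Proof.
move=> JK i0K i0J; have i0D : i0 \notin blocks J.
  by apply: contra i0J => i0D; rewrite -(blocksI JK) inE i0D.
by split=> //; rewrite /vJ -wJ_word ?blocksI //; exact: blocks_blocky.
Qed.

(** * Crossings of v_J and its minimality *)

Lemma crosses_vD c (D : {set 'Z_n}) i : blocky D -> c \in K -> c \notin D -> i \in K -> i \in D ->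
  crosses (rep i) (rep i + (gap i)%:Z) (vD c D).
Proof.
move=> bD cK cD iK iD; apply/(crosses_Omega _ _ _ Omega_tau0).
have [k kn ei] := ord_repr c i.
have [gK /andP[g0 _] _] := gapP iK.
(* The base point [c] is i + (n - k) and lies in [K], so the run from [i] ends before the word wraps
   round and stays contiguous. *)
have kg : (gap i <= n - k)%N.
  by apply: gap_le; rewrite // ?subn_gt0 // ei -addrA -natrD subnKC ?addrn // ltnW.
have e : arc c n = arc c k ++ arc i (gap i) ++ arc (i + (gap i)%:R) (n - k - gap i).
  by rewrite -arcD {1}ei -arcD; congr arc; lia.
have eblock : [seq d <- arc i (gap i) | d \in D] = arc i (gap i).
  by apply/all_filterP/allP => d /arcP[l hl ->]; rewrite blocky_gap.
have u := cword_uniq c D; move: u; rewrite /cword e !filter_cat eblock.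
rewrite !cat_uniq has_cat negb_or => /and3P[_ /andP[/hasPn n1 _] /and3P[_ /hasPn n2 _]].
(* The shift by [tau0] moves the threshold from i + gap i to the last letter of the run. *)
have -> : rep i + (gap i)%:Z + wdeg (tau0 n) = rep i + (gap i).-1%:Z.
  by rewrite wdeg_tau0; lia.
have /= := @crosses_arc (rep i) (gap i); rewrite clsK; apply=> //.
  by apply: n1; apply/arcP; exists 0%N; rewrite ?addr0.
apply/negP => /n2 /negP; apply; apply/arcP.
by exists (gap i).-1 => //; rewrite prednK.
Qed.

Lemma crosses_block v r i l : v = (word r * tau0 n)%g ->
  crosses (rep i) (rep i + (gap i)%:Z) v -> (l < gap i)%N -> i + l%:R \in r.
Proof.
move=> -> /(crosses_Omega _ _ _ Omega_tau0); rewrite wdeg_tau0 => h hl.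
rewrite -(clsK i) -cls_nat -clsD; apply: (crosses_letters h); lia.
Qed.

Lemma mem_crosses_vD c (D : {set 'Z_n}) i : i \in K ->
  crosses (rep i) (rep i + (gap i)%:Z) (vD c D) -> i \in D.
Proof.
move=> iK /(crosses_block (l := 0) erefl); rewrite addr0 mem_cword; apply.
by have [_ /andP[]] := gapP iK.
Qed.

Lemma cls_gap i : i \in K -> cls (rep i + (gap i)%:Z) \in K.
Proof. by move=> iK; rewrite clsD clsK cls_nat; have [] := gapP iK. Qed.

(** Conjugation by [tau0] preserves W_a, so every element of the double coset has Omega-component
    [tau0], and its length is that of a word in front of [tau0]. *)
Lemma has_length_dcoset_tau0 v w m : affine_weyl w -> dcoset (w * tau0 n)%g v ->
  has_length v m ->
  exists r, v = (word r * tau0 n)%g /\ (size r <= m)%N.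
Proof.
move=> aw [a [b [pa pb ev]]] [w' [om [aw' Oom ev' [[r er sr] _]]]].
exists r; rewrite sr er; split=> //; rewrite ev'; congr (_ * _)%g.
apply: (Omega_affine_eq (v := w') (v' := (a * w * (tau0 n * b * (tau0 n)^-1))%g)) => //.
- exact: Omega_tau0.
- apply: affine_weylM; first by apply: affine_weylM aw; exact: parahoric_affine.
  have /affine_weylE[mb db] := parahoric_affine pb.
  apply/affine_weylE; rewrite !iw_multM !wdegM iw_multV wdegV mb db.
  by rewrite !addr0 !subrr.
by rewrite -ev' ev !mulgA mulgVK.
Qed.

(** The crossing of each block persists in the double coset and forces every letter of the block
    into any competing word, while [cword] uses each letter once. *)
Lemma vD_min_length c (J : {set 'Z_n}) : J \subset K -> c \in K -> c \notin blocks J ->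
  is_min_length (dcoset (vD c (blocks J))) (vD c (blocks J)).
Proof.
move=> JK cK cD; split; first exact: dcoset_refl.
exists (size (cword c (blocks J))).
  exists (word (cword c (blocks J))), (tau0 n); split=> //.
  - exact: affine_weyl_word.
  - exact: Omega_tau0.
  exact/coxeter_length_uniq/cword_uniq.
move=> v m Cv lv.
have [r [er szr]] := has_length_dcoset_tau0 (affine_weyl_word _) Cv lv.
apply: leq_trans szr; apply: uniq_leq_size (cword_uniq _ _) _ => d.
rewrite mem_cword => /blocksP[i [l [iJ hl ->]]].
have iK : i \in K by exact: (fintype.subsetP JK).
apply: (crosses_block er _ hl); apply: (crosses_dcoset _ _ Cv); rewrite ?cls_gap ?clsK //.
apply: crosses_vD => //; first exact: blocks_blocky.
by move: iJ; rewrite -{1}(blocksI JK) inE => /andP[].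
Qed.

(** * Comparison of the orders and bijectivity *)

Lemma dcoset_le_subset i0 i0' (J J' : {set 'Z_n}) : J \proper K -> J' \proper K ->
  i0 \in K :\: J -> i0' \in K :\: J' ->
  (J \subset J' <-> double_coset_le (dcoset (vJ K i0 J)) (dcoset (vJ K i0' J'))).
Proof.
move=> /proper_sub JK /proper_sub J'K; rewrite !inE => /andP[i0J i0K] /andP[i0J' i0K'].
have [i0D ->] := vJ_word JK i0K i0J; have [i0D' ->] := vJ_word J'K i0K' i0J'.
split=> [JJ'|[u [u' [[Cu _] [Cu' _] le]]]].
  (* The base point for [J'] also serves for the smaller [J], so both words are read off the same
     arc. *)
  have i0'D : i0' \notin blocks J by apply: contra i0D'; exact/fintype.subsetP/blocksS.
  exists (vD i0' (blocks J)), (vD i0' (blocks J')); split.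
  - rewrite (word_cword i0D i0'D); exact: vD_min_length.
  - exact: vD_min_length.
  exists (word (cword i0' (blocks J))), (word (cword i0' (blocks J'))), (tau0 n).
  split; split=> //; try exact: affine_weyl_word; first exact: Omega_tau0.
  apply: subseq_bruhat (cword_uniq _ _) _.
  have -> : cword i0' (blocks J) = [seq d <- cword i0' (blocks J') | d \in blocks J].
    rewrite /cword -filter_predI; apply: eq_filter => d /=.
    by case: (boolP (d \in blocks J)) => // /(fintype.subsetP (blocksS JJ')) ->.
  exact: filter_subseq.
apply/fintype.subsetP => i iJ; have iK := fintype.subsetP JK _ iJ; have gK := cls_gap iK.
have cK : cls (rep i) \in K by rewrite clsK.
rewrite -(blocksI J'K) inE iK andbT; apply: (@mem_crosses_vD i0') => //.
(* The crossing travels from [v_J] to [u], up to [u'], and then to [v_J']; the last passage needs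
   [v_J'] as a member of the double coset of [u']. *)
have [a [b [pa pb eu']]] := Cu'.
apply: (crosses_dcoset (v := u')) => //.
  exists a^-1%g, b^-1%g; rewrite eu' !mulgA mulVg mul1g mulgK.
  by split=> //; exact: parahoricV.
apply: crosses_bruhat_le le _; apply: (crosses_dcoset _ _ Cu) => //.
apply: crosses_vD => //; first exact: blocks_blocky.
by move: iJ; rewrite -{1}(blocksI JK) inE => /andP[].
Qed.

Lemma cword_notin c (D : {set 'Z_n}) : c \notin D ->
  cword c D = [seq d <- arc (c + 1) p.+1 | d \in D].
Proof. by move=> cD; rewrite /cword arcS /= (negPf cD). Qed.

Lemma Adm_vD c (D : {set 'Z_n}) : c \notin D -> Adm (vD c D).
Proof.
move=> cD; apply/AdmE; exists (c + 1), (cword c D); split=> //.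
by rewrite cword_notin // filter_subseq.
Qed.

(** If [D] contained [K], walking round the circle from a point of [K] would put every letter into
    [D], including [c]. *)
Lemma blocky_proper c (D : {set 'Z_n}) : K != finset.set0 -> blocky D -> c \notin D -> D :&: K \proper K.
Proof.
move=> /finset.set0Pn[k kK] bD cD; rewrite finset.properEneq finset.subsetIr andbT.
apply: contraNneq cD => DK; have [l _ ->] := ord_repr k c.
have KD : K \subset D by rewrite -DK finset.subsetIl.
elim: l => [|l ih]; first by rewrite addr0 (fintype.subsetP KD).
have [/(fintype.subsetP KD) //|/bD ->] := boolP (k + l.+1%:R \in K).
by rewrite mulrSr addrA addrK.
Qed.

Lemma dcoset_vJ_bij (i0 : {set 'Z_n} -> 'Z_n) : K != finset.set0 ->
  (forall J : {set 'Z_n}, J \proper K -> i0 J \in K :\: J) ->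
  set_bij (proper_subsets K) (Adm_cosets K) (fun J => dcoset (vJ K (i0 J) J)).
Proof.
move=> K0 i0P; split.
- move=> J /= JK; have := i0P J JK; rewrite inE => /andP[i0J i0K].
  have [i0D e] := vJ_word (proper_sub JK) i0K i0J.
  by exists (vJ K (i0 J) J) => //; rewrite e; exact: Adm_vD.
- move=> J J' /classical_sets.set_mem /= JK /classical_sets.set_mem /= J'K e.
  have le_refl (J1 : {set 'Z_n}) : J1 \proper K ->
      double_coset_le (dcoset (vJ K (i0 J1) J1)) (dcoset (vJ K (i0 J1) J1)).
    by move=> J1K; apply/dcoset_le_subset; rewrite ?i0P.
  apply/eqP; rewrite finset.eqEsubset; apply/andP; split.
    by apply/(dcoset_le_subset JK J'K (i0P _ JK) (i0P _ J'K)); rewrite -e; exact: le_refl.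
  by apply/(dcoset_le_subset J'K JK (i0P _ J'K) (i0P _ JK)); rewrite -e; exact: le_refl.
move=> _ [v /AdmE[j [r [sub ->]]] <-].
(* The arc of n - 1 letters from [j] omits exactly [j - 1], which becomes the base point; its
   letters being distinct, a subword is recovered from its set of letters. *)
pose c := j - 1; pose D := [set d in r]%SET.
have u : uniq (c :: arc j p.+1).
  by have := arc_uniq c (leqnn n); rewrite arcS subrK.
have cD : c \notin D.
  by rewrite inE; apply: contraL u => /(mem_subseq sub) cr; rewrite /= cr.
have er : r = cword c D.
  rewrite cword_notin // subrK.
  rewrite [LHS](subseq_uniqP _ sub) //; last by case/andP: u.
  by apply: eq_filter => d; rewrite inE.
rewrite er; have [D' [cD' bD' ->]] := dcoset_vD_blocky cD.
have JK := blocky_proper K0 bD' cD'.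
exists (D' :&: K) => //; have := i0P _ JK; rewrite inE => /andP[i0J i0K].
(* The prescribed base point is in [K] but not in [D' :&: K], so it is outside [D'] and can replace
   [c]. *)
have i0D : i0 (D' :&: K) \notin D' by apply: contra i0J; rewrite inE i0K andbT.
by rewrite /vJ wJ_word // (word_cword cD' i0D).
Qed.

End AdmissibleSet.

(* [i0] is an arbitrary choice of base points i_0 in Ibar \ J. *)
Theorem propositionB (n : nat) (n_ge2 : (2 <= n)%N)
    (eps : int) (eps_pm1 : eps = 1%R \/ eps = (- 1)%R)
    (I : {set 'I_(nu n eps).+1}) (I_nonempty : I != finset.set0)
    (i0 : {set 'Z_n} -> 'Z_n)
    (i0P : forall J : {set 'Z_n}, J \proper Ibar I ->
       i0 J \in (Ibar I :\: J)%SET) :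
  set_bij (proper_subsets (Ibar I)) (Adm_cosets (Ibar I))
    (fun J => double_coset (Ibar I) (vJ (Ibar I) (i0 J) J)) /\
  (forall J J' : {set 'Z_n}, J \proper Ibar I -> J' \proper Ibar I ->
     (J \subset J' <->
      double_coset_le (double_coset (Ibar I) (vJ (Ibar I) (i0 J) J))
                      (double_coset (Ibar I) (vJ (Ibar I) (i0 J') J')))).
Proof.
have Ibar0 : Ibar I != finset.set0.
  have [r rI] := finset.set0Pn _ I_nonempty.
  apply/finset.set0Pn; exists (r%:Z)%:~R; rewrite inE; apply/orP; left.
  by apply/imsetP; exists r.
move: (Ibar I) Ibar0 i0P => K K0 i0P {eps eps_pm1 I I_nonempty}.
case: n n_ge2 i0 K K0 i0P => [//|[//|p]] _ i0 K K0 i0P.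
split; first exact: dcoset_vJ_bij.
by move=> J J' JK J'K; apply: dcoset_le_subset => //; exact: i0P.
Qed.
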